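(* Let $\mathcal{G}=(\mathcal{V},\mathcal{E})$ be a $d$-regular cell graph and let $f:\mathbb{R}^n\to\mathbb{R}$, $n=|\mathcal{V}|$, be of the form $$f(x)=\sum_{e\in\mathcal{E}}\phi(x_{\rho(e)},x_{\tau(e)}),$$ with $\phi:\mathbb{R}^2\to\mathbb{R}$ smooth and $\mathbf{Z}_2$-invariant. Then, generically, a totally synchronous critical point $x^0=(x_0,\dots,x_0)$ of $f$ is a minimum of $f$ if and only if $$\phi_{11}(x_0,x_0)+\phi_{12}(x_0,x_0)>0\quad\text{and}\quad \phi_{11}(x_0,x_0)+\Bigl(1-\frac{\lambda}{d}\Bigr)\phi_{12}(x_0,x_0)>0,$$ where $\lambda$ is the greatest eigenvalue of the Laplacian of $\mathcal{G}$.
   Context: A cell graph is a finite connected undirected graph without multiple edges; loops are disregarded, so $\mathcal{E}$ is the set of edges joining distinct vertices. It is $d$-regular ($d\geq 1$) if every vertex has exactly $d$ neighbours. Each vertex $v$ carries a one-dimensional variable $x_v\in\mathbb{R}$. For an edge $e$, $\rho(e)$ and $\tau(e)$ denote its two endpoints (the order is irrelevant since $\phi$ is symmetric). $\mathbf{Z}_2$-invariant means $\phi(x,y)=\phi(y,x)$. Subscripts 1 and 2 denote partial derivatives of $\phi$ with respect to its first and second variable. The graph Laplacian is $D-A$, with $D$ the degree matrix and $A$ the adjacency matrix. ''Minimum'' means local minimum. ''Generically'' means: under the assumption that the Hessian matrix of $f$ at $x^0$ is nondegenerate. *)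

(* Defs.v *)
From HB Require Import structures.
From mathcomp Require Import all_boot all_order all_algebra.
From mathcomp Require Import all_classical all_reals all_analysis.

Set Implicit Arguments.
Unset Strict Implicit.
Unset Printing Implicit Defensive.
Import Order.TTheory GRing.Theory Num.Theory.
Import numFieldNormedType.Exports.

Local Open Scope classical_set_scope.
Local Open Scope ring_scope.

Section Graphs.
Variables (n : nat) (E : {set {set 'I_n}}).

Definition adj : rel 'I_n := fun u v => [set u; v]%SET \in E.

(* Edges are two-element sets of vertices: this excludes loops and multiple
   edges. *)
Record cell_graph : Prop := CellGraph {
  cell_graph_nonempty : (0 < n)%N ;
  cell_graph_edge : forall e, e \in E -> #|e| = 2%N ;
  cell_graph_connected : forall u v, connect adj u v
}.

Definition degree (v : 'I_n) : nat := #|[set u | adj v u]%SET|.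

Definition regular (d : nat) : Prop := forall v, degree v = d.

(* rho e and tau e are the two endpoints of the edge e, in an arbitrary
   order. *)
Definition endpoints (rho tau : {set 'I_n} -> 'I_n) : Prop :=
  forall e, e \in E -> e = [set rho e; tau e]%SET.

Definition degree_mx (R : pzRingType) : 'M[R]_n :=
  diag_mx (\row_v (degree v)%:R).

Definition adjacency_mx (R : pzRingType) : 'M[R]_n :=
  \matrix_(u, v) (adj u v)%:R.

Definition laplacian_mx (R : pzRingType) : 'M[R]_n :=
  degree_mx R - adjacency_mx R.

End Graphs.

Definition greatest_eigenvalue (R : realFieldType) (n : nat) (A : 'M[R]_n)
    (lambda : R) : Prop :=
  eigenvalue A lambda /\ forall mu, eigenvalue A mu -> mu <= lambda.

Section Calculus.
Variable R : realType.

(* In finite dimension, the derivative 'd g is of class C^k iff each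
   directional derivative 'D_v g is. *)
Fixpoint class_C (V : normedModType R) (k : nat) (g : V -> R) : Prop :=
  if k is k'.+1 then
    (forall x, differentiable g x) /\ (forall v, class_C k' ('D_v g))
  else continuous g.

Definition smooth (V : normedModType R) (g : V -> R) : Prop :=
  forall k, class_C k g.

Definition Z2_invariant (phi : R * R -> R) : Prop :=
  forall x y, phi (x, y) = phi (y, x).

Definition partial1 (phi : R * R -> R) : R * R -> R := 'D_((1, 0) : R * R) phi.
Definition partial2 (phi : R * R -> R) : R * R -> R := 'D_((0, 1) : R * R) phi.

Definition partial (n : nat) (i : 'I_n) (f : 'rV[R]_n -> R) : 'rV[R]_n -> R :=
  'D_(delta_mx 0 i) f.

Definition critical_point (n : nat) (f : 'rV[R]_n -> R) (x : 'rV[R]_n) : Prop :=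
  forall i, partial i f x = 0.

Definition hessian (n : nat) (f : 'rV[R]_n -> R) (x : 'rV[R]_n) : 'M[R]_n :=
  \matrix_(i, j) partial i (partial j f) x.

Definition local_minimum (n : nat) (f : 'rV[R]_n -> R) (x : 'rV[R]_n) : Prop :=
  \forall y \near x, f x <= f y.

End Calculus.

(* Main.v *)
Require Import Defs.
From mathcomp Require Import all_boot all_order all_algebra.
From mathcomp Require Import all_classical all_reals all_analysis.
From mathcomp Require Import ring lra.
Import Order.TTheory GRing.Theory Num.Theory.
Import numFieldNormedType.Exports.

Set Implicit Arguments.
Unset Strict Implicit.
Unset Printing Implicit Defensive.

Local Open Scope classical_set_scope.
Local Open Scope ring_scope.

(** Write a = phi_11(x0,x0) and b = phi_12(x0,x0).  Since phi is symmetric,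
    phi_2(x,y) = phi_1(y,x), so a sum over the edges of the two endpoint
    contributions is a sum over the arcs of the graph, and

      partial_i f (x) = sum over the neighbours v of i of phi_1(x_i, x_v).

    Differentiating once more at the synchronous point gives d a on the
    diagonal, b for adjacent vertices and 0 elsewhere ([hessian_synchronous]):
    the Hessian is H = d a I + b A = d (a + b) I - b L, where A is the adjacency
    matrix and L = d I - A the Laplacian.  With c = d (a + b), an
    eigenvector of L for mu is thus an eigenvector of H for c - b mu.

    If the point is a minimum, then H is positive semidefinite
    ([local_minimum_hessian_psd]), and as H is invertible its eigenvalues are
    positive.  The constant vector (mu = 0) and an eigenvector for
    mu = lambda give the two inequalities.

    Conversely, the quadratic form of L is a sum of squares over the edges
    ([quad_laplacian]), hence nonnegative, and it is at most lambda |v|^2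
    because the maximum of the Rayleigh quotient of a symmetric matrix is an
    eigenvalue ([rayleigh_max]).  The expression c |v|^2 - b y is affine in
    y, so on 0 <= y <= lambda |v|^2 it is at least |v|^2 times the smaller of
    c and c - b lambda.  Both are positive, H is coercive, and the
    second-order Taylor expansion makes the point a minimum
    ([hessian_coercive_local_minimum]).  The second inequality of the theorem
    is c - b lambda > 0 divided by d. *)

(** * Quadratic forms of symmetric matrices *)

Section QuadraticForms.
Variables (R : realType) (n : nat).
Implicit Types (u v w : 'rV[R]_n) (A B : 'M[R]_n).

Definition dotv u v : R := \sum_i u 0 i * v 0 i.

Definition quad A v : R := dotv (v *m A) v.

Lemma dotvC u v : dotv u v = dotv v u.
Proof. by apply: eq_bigr => i _; rewrite mulrC. Qed.

Lemma dotvDl u v w : dotv (u + v) w = dotv u w + dotv v w.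
Proof. by rewrite -big_split; apply: eq_bigr => i _; rewrite mxE mulrDl. Qed.

Lemma dotvZl (c : R) u v : dotv (c *: u) v = c * dotv u v.
Proof. by rewrite mulr_sumr; apply: eq_bigr => i _; rewrite mxE mulrA. Qed.

Lemma dotvDr u v w : dotv u (v + w) = dotv u v + dotv u w.
Proof. by rewrite dotvC dotvDl !(dotvC u). Qed.

Lemma dotvZr (c : R) u v : dotv u (c *: v) = c * dotv u v.
Proof. by rewrite dotvC dotvZl dotvC. Qed.

Lemma dotvv_ge0 v : 0 <= dotv v v.
Proof. by apply: sumr_ge0 => i _; rewrite -expr2 sqr_ge0. Qed.

Lemma dotvv_eq0 v : (dotv v v == 0) = (v == 0).
Proof.
apply/idP/eqP => [|->]; last by rewrite /dotv big1 // => i _; rewrite mxE mul0r.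
rewrite psumr_eq0 => [/allP v0|i _]; last by rewrite -expr2 sqr_ge0.
apply/rowP => i; have := v0 i (mem_index_enum i).
by rewrite mxE -expr2 sqrf_eq0 => /eqP.
Qed.

Lemma dotvv_gt0 v : v != 0 -> 0 < dotv v v.
Proof. by move=> v0; rewrite lt_def dotvv_ge0 dotvv_eq0 v0. Qed.

(** The norm of row vectors is the sup norm, so this is the comparison between
    the two norms that turns Euclidean bounds into topological ones. *)
Lemma normr_sqr_le_dotvv v : `|v| ^+ 2 <= dotv v v.
Proof.
have [->|v0] := eqVneq v 0; first by rewrite normr0 expr0n dotvv_ge0.
have [[i j] /= ->] : exists i, `|v| = `|v i.1 i.2|.
  by apply: mx_norm_neq0; rewrite -[X in X != _]/(`|v|) normr_eq0.
rewrite (ord1 i) real_normK ?num_real// /dotv (bigD1 j) //= -expr2 lerDl.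
by apply: sumr_ge0 => k _; rewrite -expr2 sqr_ge0.
Qed.

Lemma dotv_mulmx_sym A u v : A^T = A -> dotv (u *m A) v = dotv u (v *m A).
Proof.
move=> sA.
have dotE (x y : 'rV[R]_n) : dotv x y = (x *m y^T) 0 0.
  by rewrite mxE; apply: eq_bigr => i _; rewrite mxE.
by rewrite !dotE trmx_mul sA mulmxA.
Qed.

Lemma quad_eigen A v (mu : R) : v *m A = mu *: v -> quad A v = mu * dotv v v.
Proof. by move=> vA; rewrite /quad vA dotvZl. Qed.

Lemma quadZ A (c : R) v : quad A (c *: v) = c ^+ 2 * quad A v.
Proof. by rewrite /quad -scalemxAl dotvZl dotvZr mulrA expr2. Qed.

(** A zero of a nonnegative quadratic form is a minimum of it, so its gradient
    2 v A vanishes there.  Concretely, the form is evaluated on v + t (v A) for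
    a suitable t <= 0. *)
Lemma psd_quad_eq0 A v : A^T = A -> (forall w, 0 <= quad A w) ->
  quad A v = 0 -> v *m A = 0.
Proof.
move=> sA psd qv; apply/eqP; rewrite -dotvv_eq0.
set c := dotv _ _; set q := quad A (v *m A).
have q1 : 0 < q + 1 by rewrite ltr_wpDl // psd.
(* On v + t (v A) the form is 2 t c + t^2 q.  The choice t = - c / (q + 1), with
   q + 1 rather than q because q may vanish, makes it negative unless c = 0. *)
have : 0 <= quad A (v + (- (c / (q + 1))) *: (v *m A)).
  exact: psd.
have -> : quad A (v + (- (c / (q + 1))) *: (v *m A)) =
    - (c ^+ 2 * (q + 2) / (q + 1) ^+ 2).
  rewrite /quad mulmxDl dotvDl !dotvDr -scalemxAl !dotvZl !dotvZr.
  rewrite -/(quad A v) qv -/(quad A (v *m A)) -/q -/c.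
  rewrite (dotv_mulmx_sym (v *m A) v sA) -/c.
  by field; rewrite gt_eqF.
rewrite oppr_ge0 pmulr_lle0 ?invr_gt0 ?exprn_gt0 //.
rewrite pmulr_lle0; last by rewrite ltr_wpDl // psd.
by rewrite real_exprn_even_le0 ?num_real //= => /orP[//|].
Qed.

Lemma continuous_sum (T : topologicalType) (I : Type) (r : seq I) (P : pred I)
    (F : I -> T -> R) :
  (forall i, P i -> continuous (F i)) ->
  continuous (fun x => \sum_(i <- r | P i) F i x).
Proof. by move=> cF; apply: continuous_big => //; exact: add_continuous. Qed.

Lemma quad_continuous A : continuous (quad A).
Proof.
have cm i : continuous (fun w : 'rV[R]_n => (w *m A) 0 i).
  rewrite [X in continuous X](_ : _ = fun w => \sum_j w 0 j * A j i).
    apply: continuous_sum => j _ w; apply: (@continuousM _ _ (fun v => v 0 j)).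
      exact: coord_continuous.
    exact: cst_continuous.
  by apply/funext => w; rewrite mxE.
apply: continuous_sum => i _ v; apply: continuousM; first exact: cm.
exact: coord_continuous.
Qed.

Lemma unit_sphere_compact : compact [set v | dotv v v = 1].
Proof.
have box : compact [set v : 'rV[R]_n | forall i, `[-1, 1]%classic (v ord0 i)].
  exact: rV_compact (fun=> @segment_compact _ _ _).
apply: (subclosed_compact _ box).
- apply: (@preimage_closed _ _ (fun v => dotv v v) [set 1]) => //.
  move=> v _; apply: continuous_sum => i _ w.
  by apply: continuousM; exact: coord_continuous.
move=> v /= v1 i; rewrite in_itv /= -ler_norml -(@expr_le1 _ 2) //.
rewrite -v1 real_normK ?num_real // /dotv (bigD1 i) //= -expr2 lerDl.
by apply: sumr_ge0 => k _; rewrite -expr2 sqr_ge0.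
Qed.

(** The form attains a maximum on the compact unit sphere, at v0 say, with value
    mu.  By homogeneity mu |v|^2 - quad A v is nonnegative for all v and zero at
    v0, so v0 is in the kernel of mu I - A by [psd_quad_eq0]: the maximum is an
    eigenvalue. *)
Lemma rayleigh_max A : (0 < n)%N -> A^T = A ->
  exists2 mu, eigenvalue A mu & forall v, quad A v <= mu * dotv v v.
Proof.
move=> n0 sA.
have S0 : [set v : 'rV[R]_n | dotv v v = 1] !=set0.
  exists (delta_mx 0 (Ordinal n0)) => /=.
  rewrite /dotv (bigD1 (Ordinal n0)) //= !mxE !eqxx mul1r big1 ?addr0 // => i.
  by rewrite !mxE eqxx /= => /negPf ->; rewrite mul0r.
have [|v0] := EVT_max_rV (f := quad A) S0 unit_sphere_compact.
  exact/continuous_subspaceT/quad_continuous.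
rewrite inE /= => v01 v0max.
have qle v : quad A v <= quad A v0 * dotv v v.
  have [->|vN0] := eqVneq v 0.
    have /eqP d0 : dotv (0 : 'rV[R]_n) 0 == 0 by rewrite dotvv_eq0.
    by rewrite /quad mul0mx d0 mulr0.
  have vv := dotvv_gt0 vN0; set r := Num.sqrt (dotv v v).
  have r2 : r ^+ 2 = dotv v v by rewrite sqr_sqrtr // ltW.
  have r0 : r != 0 by rewrite sqrtr_eq0 -ltNge.
  have := v0max (r^-1 *: v).
  rewrite inE /= dotvZl dotvZr -r2 quadZ exprVn mulrA -expr2 exprVn.
  rewrite mulVf ?sqrf_eq0 // => /(_ erefl).
  by rewrite ler_pdivrMl ?r2 // mulrC.
exists (quad A v0) => //.
apply/eigenvalueP; exists v0; last first.
  by rewrite -dotvv_eq0 v01 oner_eq0.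
have quadB v : quad ((quad A v0)%:M - A) v = quad A v0 * dotv v v - quad A v.
  rewrite /quad mulmxBr dotvDl mul_mx_scalar dotvZl; congr (_ + _).
  by rewrite -scaleN1r dotvZl mulN1r.
apply/eqP; rewrite eq_sym -subr_eq0 -mul_mx_scalar -mulmxBr; apply/eqP.
apply: psd_quad_eq0.
- by rewrite raddfB /= tr_scalar_mx sA.
- by move=> w; rewrite quadB subr_ge0.
- by rewrite quadB v01 mulr1 subrr.
Qed.

End QuadraticForms.

(** * Second-derivative tests *)

Section SecondDerivativeTest.
Variables (R : realType) (n : nat).
Implicit Types (f : 'rV[R]_n -> R) (p v w : 'rV[R]_n).

Lemma coord_le_norm v (i : 'I_n) : `|v 0 i| <= `|v|.
Proof.
rewrite [X in _ <= X]mx_normrE.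
exact: (le_bigmax _ (fun ij => `|v ij.1 ij.2|) (0, i)).
Qed.

Lemma derive_partials f p w : differentiable f p ->
  'D_w f p = \sum_i w 0 i * partial i f p.
Proof.
move=> df; rewrite deriveE // {1}(row_sum_delta w) linear_sum.
by apply: eq_bigr => i _; rewrite linearZ /partial deriveE.
Qed.

Lemma quad_hessian f p w : (forall i, differentiable (partial i f) p) ->
  quad (hessian f p) w = \sum_i w 0 i * 'D_w (partial i f) p.
Proof.
move=> d2f; apply: eq_bigr => i _; rewrite mulrC; congr (_ * _).
by rewrite derive_partials // mxE; apply: eq_bigr => j _; rewrite mxE.
Qed.

(** The chain rule along a ray, which reduces Taylor's formula to the mean value
    theorem on the unit interval. *)
Lemma is_derive_ray f p w (t : R) : differentiable f (p + t *: w) ->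
  is_derive t 1 (fun s : R => f (p + s *: w)) ('D_w f (p + t *: w)).
Proof.
move=> df; have dg : is_diff t (fun s : R => p + s *: w) ( *:%R^~ w).
  by apply: is_diff_eq; rewrite add0r.
have dfg : is_diff t (f \o (fun s : R => p + s *: w))
    ('d f (p + t *: w) \o *:%R^~ w).
  by apply: is_diff_comp; apply: differentiableP.
apply: DeriveDef; first exact/diff_derivable.
by rewrite deriveE // diff_val /= scale1r deriveE.
Qed.

Lemma derivative_increment f p (e : R) : differentiable f p -> 0 < e ->
  \forall w \near (0 : 'rV[R]_n), `|f (p + w) - f p - 'D_w f p| <= e * `|w|.
Proof.
move=> df e0.
have /eqaddoP/(_ e e0) := diff_locally df.
apply: filterS => w /=; rewrite !fctE /= opprD addrA [w + p]addrC deriveE //.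
Qed.

(** The mean value theorem is applied to f along the ray from p to p + w, minus
    the first- and second-order terms of its Taylor polynomial.  The derivative
    of this difference at t is a combination of the first-order errors of the partial derivatives
    at p, with coefficients w_i, so it is o(|w|^2).  Hence differentiability of
    the partial derivatives at the single point p suffices. *)
Lemma taylor_order2 f p (e : R) :
  (forall x, differentiable f x) ->
  (forall i, differentiable (partial i f) p) -> 0 < e ->
  \forall w \near (0 : 'rV[R]_n),
    `|f (p + w) - f p - 'D_w f p - quad (hessian f p) w / 2| <= e * `|w| ^+ 2.
Proof.
move=> df d2f e0.
(* There are n error terms; n.+1 avoids a division by zero when n = 0. *)
have e'0 : 0 < e / n.+1%:R by rewrite divr_gt0.
have : \forall w \near nbhs (0 : 'rV[R]_n), forall i : 'I_n,
    `|partial i f (p + w) - partial i f p - 'D_w (partial i f) p|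
      <= e / n.+1%:R * `|w|.
  by apply: filter_forall => i; exact: derivative_increment.
move=> /nbhs_ballP[r /= r0 incr].
apply/nbhs_ballP; exists r => //= w; rewrite -ball_normE /= sub0r normrN => wr.
pose q := quad (hessian f p) w.
pose h (t : R) := f (p + t *: w) - t * 'D_w f p - t ^+ 2 * (q / 2).
pose dh (t : R) : R := 'D_w f (p + t *: w) - 'D_w f p - t * q.
have hdh (t : R) : is_derive t (1 : R) h (dh t).
  have d0 := is_derive_ray (df (p + t *: w)).
  have d1 : is_derive t (1 : R) ('D_w f p \*: (@id R)) ('D_w f p).
    by apply: is_derive_eq; rewrite /GRing.scale /= mulr1.
  have d2 : is_derive t (1 : R) ((q / 2) \*: (@id R) ^+ 2) (t * q).
    by apply: is_derive_eq; rewrite /GRing.scale /= !expr1; field.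
  rewrite (_ : h = (fun s => f (p + s *: w)) - 'D_w f p \*: (@id R)
                   - (q / 2) \*: (@id R) ^+ 2).
    exact: is_deriveB.
  apply/funext => s.
  change (h s = f (p + s *: w) - 'D_w f p * s - q / 2 * s ^+ 2).
  by rewrite /h; ring.
have [|t /[!in_itv] /andP[t0 t1]] := MVT (@ltr01 R) (fun t _ => hdh t).
  apply: derivable_within_continuous => t _; exact: ex_derive.
rewrite subr0 mulr1.
have -> : h 1 - h 0 = f (p + w) - f p - 'D_w f p - q / 2.
  by rewrite /h scale1r scale0r addr0; ring.
move=> ->.
have -> : dh t = \sum_i w 0 i * (partial i f (p + t *: w) - partial i f p
    - 'D_(t *: w) (partial i f) p).
  rewrite /dh /q quad_hessian // !derive_partials //.
  rewrite mulr_sumr -!sumrB; apply: eq_bigr => i _.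
  have -> : 'D_(t *: w) (partial i f) p = t * 'D_w (partial i f) p.
    by rewrite !deriveE // linearZ.
  by ring.
have tw : `|t *: w| <= `|w|.
  by rewrite normrZ gtr0_norm // ler_piMl // ltW.
apply: (le_trans (ler_norm_sum _ _ _)).
apply: (@le_trans _ _ (\sum_(i < n) (e / n.+1%:R * `|w| ^+ 2))).
  apply: ler_sum => i _; rewrite normrM expr2 mulrA mulrC.
  apply: ler_pM => //; last first.
    exact: coord_le_norm.
  apply: (le_trans (incr (t *: w) _ i)).
    by rewrite -ball_normE /= sub0r normrN (le_lt_trans tw).
  by rewrite ler_wpM2l // ltW.
rewrite sumr_const card_ord -[X in X <= _]mulr_natr.
rewrite mulrAC ler_wpM2r ?exprn_ge0 // -mulrA ler_piMr ?(ltW e0) //.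
by rewrite mulrC ler_pdivrMr // mul1r ler_nat.
Qed.

(** Along a direction v with quad v = q < 0, the increment of f at t v is
    t^2 q / 2 + o(t^2), which is negative for small t. *)
Lemma local_minimum_hessian_psd f p :
  (forall x, differentiable f x) ->
  (forall i, differentiable (partial i f) p) ->
  critical_point f p -> local_minimum f p ->
  forall v, 0 <= quad (hessian f p) v.
Proof.
move=> df d2f crit minf v; rewrite leNgt; apply/negP => qv.
set q := quad _ _ in qv.
have v1 : 0 < `|v| ^+ 2 + 1 by rewrite ltr_wpDl // exprn_ge0.
(* With this e the Taylor error e t^2 |v|^2 is less than half of - t^2 q / 2. *)
pose e := - q / (4 * (`|v| ^+ 2 + 1)).
have e0 : 0 < e by rewrite divr_gt0 ?oppr_gt0 // mulr_gt0.
have /nbhs_ballP[r /= r0 tay] := taylor_order2 df d2f e0.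
have /nbhs_ballP[s /= s0 mins] := minf.
pose t := Num.min r s / (`|v| + 1) / 2.
have v2 : 0 < `|v| + 1 by rewrite ltr_wpDl.
have m0 : 0 < Num.min r s by rewrite lt_min r0.
have t0 : 0 < t by rewrite !divr_gt0.
have tv : `|t *: v| < Num.min r s.
  rewrite normrZ gtr0_norm // /t; move: (normr_ge0 v) => N0.
  rewrite -{2}(divfK (lt0r_neq0 v2) (Num.min r s)).
  have : 0 < Num.min r s / (`|v| + 1) by rewrite divr_gt0.
  by move: (_ / _) => u u0; nra.
move: tv; rewrite lt_min => /andP[tr ts].
have := tay (t *: v); rewrite -ball_normE /= sub0r normrN => /(_ tr).
have := mins (p + t *: v); rewrite -ball_normE /= opprD addNKr normrN => /(_ ts).
rewrite derive_partials // big1 ?subr0; last by move=> i _; rewrite crit mulr0.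
rewrite quadZ -/q normrZ gtr0_norm // => fle /ler_normlP[_].
have -> : q = - (4 * e * (`|v| ^+ 2 + 1)) by rewrite /e; field; rewrite gt_eqF.
have : 0 < t ^+ 2 * e by rewrite mulr_gt0 // exprn_gt0.
have : 0 <= t ^+ 2 * e * `|v| ^+ 2.
  by rewrite mulr_ge0 ?exprn_ge0 // mulr_ge0 ?exprn_ge0 // ltW.
nra.
Qed.

(** The quadratic term is at least c |w|^2 / 2, which dominates a Taylor error of
    the same size. *)
Lemma hessian_coercive_local_minimum f p (c : R) :
  (forall x, differentiable f x) ->
  (forall i, differentiable (partial i f) p) ->
  critical_point f p -> 0 < c ->
  (forall v, c * `|v| ^+ 2 <= quad (hessian f p) v) ->
  local_minimum f p.
Proof.
move=> df d2f crit c0 coer.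
have c20 : 0 < c / 2 by rewrite divr_gt0.
have /nbhs_ballP[r /= r0 tay] := taylor_order2 df d2f c20.
apply/nbhs_ballP; exists r => //= x; rewrite -ball_normE /= distrC => xr.
have := tay (x - p); rewrite -ball_normE /= sub0r normrN => /(_ xr).
rewrite derive_partials // big1 ?subr0; last by move=> i _; rewrite crit mulr0.
rewrite [p + _]addrC subrK => /ler_normlP[+ _].
have := coer (x - p); nra.
Qed.

End SecondDerivativeTest.

(** * Graphs, arcs and the Laplacian *)

Section GraphSums.
Variables (R : realType) (n : nat) (E : {set {set 'I_n}}).

Lemma adj_sym u v : adj E u v = adj E v u.
Proof. by rewrite /adj finset.setUC. Qed.

Lemma sum_neighbours_const (c : R) u :
  \sum_(v | adj E u v) c = (degree E u)%:R * c.
Proof.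
rewrite mulr_natl -sumr_const; apply: eq_bigl => v.
by rewrite inE.
Qed.

Lemma set2_eq (T : finType) (r t u v : T) : r != t ->
  ([set u; v]%SET == [set r; t]%SET) =
  ((u, v) == (r, t)) || ((u, v) == (t, r)).
Proof.
move=> rt; apply/eqP/orP => [uv|[] /eqP[-> ->] //]; last by rewrite finset.setUC.
have : u \in [set r; t]%SET by rewrite -uv set21.
have : r \in [set u; v]%SET by rewrite uv set21.
have : t \in [set u; v]%SET by rewrite uv set22.
rewrite !inE !xpair_eqE; case: (eqVneq u r) => [->|ur] /=.
  by rewrite [t == r]eq_sym (negPf rt) /= eq_sym => ->; left.
by move=> _ /eqP -> ->; right; rewrite eqxx.
Qed.

(** An edge {u, v} is the union of the two arcs (u, v) and (v, u), whatever the
    order in which rho and tau list its endpoints. *)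
Lemma sum_arcs (rho tau : {set 'I_n} -> 'I_n) (F : 'I_n -> 'I_n -> R) :
  cell_graph E -> endpoints E rho tau ->
  \sum_(e in E) (F (rho e) (tau e) + F (tau e) (rho e)) =
  \sum_u \sum_(v | adj E u v) F u v.
Proof.
move=> [_ card2 _] ends; rewrite pair_big_dep /=.
rewrite [RHS](partition_big (fun uv => [set uv.1; uv.2]%SET) (mem E)) //=.
apply: eq_bigr => e eE.
have rt : rho e != tau e.
  by have := card2 e eE; rewrite {1}(ends e eE) cards2; case: eqP.
have arcs (uv : 'I_n * 'I_n) : adj E uv.1 uv.2 && ([set uv.1; uv.2]%SET == e) =
    (uv == (rho e, tau e)) || (uv == (tau e, rho e)).
  case: uv => u v /=; rewrite -set2_eq // /adj -(ends e eE).
  by case: eqP => [->|]; rewrite ?eE ?andbF.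
rewrite (eq_bigl _ _ arcs) (bigD1 (rho e, tau e)) ?eqxx //=; congr (_ + _).
rewrite (big_pred1 (tau e, rho e)) // => uv /=.
case: (uv =P (tau e, rho e)) => [->|_]; last by rewrite orbF andbN.
by rewrite orbT /= xpair_eqE eq_sym (negPf rt).
Qed.

End GraphSums.

Section Laplacian.
Variables (R : realType) (n : nat) (E : {set {set 'I_n}}).

Lemma laplacian_sym : (laplacian_mx E R)^T = laplacian_mx E R.
Proof.
rewrite raddfB /= tr_diag_mx; congr (_ - _).
by apply/matrixP => u v; rewrite !mxE adj_sym.
Qed.

Lemma mulmx_laplacian (x : 'rV[R]_n) u :
  (x *m laplacian_mx E R) 0 u = \sum_(v | adj E u v) (x 0 u - x 0 v).
Proof.
rewrite mulmxBr mul_mx_diag !mxE sumrB sum_neighbours_const mulrC.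
congr (_ - _); rewrite [RHS]big_mkcond; apply: eq_bigr => v _.
by rewrite mxE adj_sym; case: adj; rewrite ?mulr1 ?mulr0.
Qed.

(** This identity, L being the matrix of the Dirichlet form of the graph, is
    why L is positive semidefinite. *)
Lemma quad_laplacian rho tau (x : 'rV[R]_n) :
  cell_graph E -> endpoints E rho tau ->
  quad (laplacian_mx E R) x = \sum_(e in E) (x 0 (rho e) - x 0 (tau e)) ^+ 2.
Proof.
move=> gE ends.
transitivity (\sum_u \sum_(v | adj E u v) (x 0 u - x 0 v) * x 0 u).
  by apply: eq_bigr => u _; rewrite mulmx_laplacian mulr_suml.
by rewrite -(sum_arcs _ gE ends); apply: eq_bigr => e _; ring.
Qed.

End Laplacian.

(** * Derivatives of sums of functions of two coordinates *)

Section SumDerivative.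
Variables (R : numFieldType) (V W : normedModType R).

Lemma is_derive_bigsum (I : Type) (r : seq I) (P : pred I) (F : I -> V -> W)
    (dF : I -> W) (x v : V) :
  (forall i, P i -> is_derive x v (F i) (dF i)) ->
  is_derive x v (fun y => \sum_(i <- r | P i) F i y) (\sum_(i <- r | P i) dF i).
Proof.
move=> dFx; elim: r => [|i r IHr].
  under eq_fun do rewrite big_nil.
  by rewrite big_nil; exact: is_derive_cst.
under eq_fun do rewrite big_cons.
rewrite big_cons; move: (dFx i); case: (P i) => // /(_ isT) dFi.
exact: is_deriveD.
Qed.

Lemma differentiable_bigsum (I : Type) (r : seq I) (P : pred I)
    (F : I -> V -> W) (x : V) :
  (forall i, P i -> differentiable (F i) x) ->
  differentiable (fun y => \sum_(i <- r | P i) F i y) x.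
Proof.
move=> dFx; elim: r => [|i r IHr].
  under eq_fun do rewrite big_nil.
  exact: differentiable_cst.
under eq_fun do rewrite big_cons.
by move: (dFx i); case: (P i) => // /(_ isT) dFi; exact: differentiableD.
Qed.

End SumDerivative.

Section TwoCoordinates.
Variables (R : realType) (n : nat).
Implicit Types (psi : R * R -> R) (x w : 'rV[R]_n).

Lemma derive_pair psi (p : R * R) (s t : R) : differentiable psi p ->
  'D_(s, t) psi p = s * partial1 psi p + t * partial2 psi p.
Proof.
move=> dpsi; rewrite /partial1 /partial2 !deriveE //.
have -> : (s, t) = s *: (1, 0) + t *: (0, 1) :> R * R.
  by apply/pair_equal_spec; split; rewrite /= /GRing.scale /=; ring.
by rewrite linearD !linearZ.
Qed.

Lemma differentiable_coord2 psi u v x : differentiable psi (x 0 u, x 0 v) ->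
  differentiable (fun y : 'rV[R]_n => psi (y 0 u, y 0 v)) x.
Proof.
move=> dpsi; apply: (@differentiable_comp _ _ _ _
  (fun y : 'rV[R]_n => (y 0 u, y 0 v)) psi) => //.
apply: (@differentiable_pair _ _ _ _ (fun y : 'rV[R]_n => y 0 u : R)
  (fun y => y 0 v : R)); exact: differentiable_coord.
Qed.

(** Taking two coordinates is linear, so the difference quotients of the
    composite are those of psi in the direction (w_u, w_v). *)
Lemma is_derive_coord2 psi u v x w : differentiable psi (x 0 u, x 0 v) ->
  is_derive x w (fun y : 'rV[R]_n => psi (y 0 u, y 0 v))
    (w 0 u * partial1 psi (x 0 u, x 0 v) + w 0 v * partial2 psi (x 0 u, x 0 v)).
Proof.
move=> dpsi; apply: DeriveDef.
  exact/diff_derivable/differentiable_coord2.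
rewrite -derive_pair // /derive.
apply: (congr1 (fun g : R -> R => lim (g @ 0^'))).
by apply/funext => h /=; rewrite !mxE.
Qed.

(** Symmetry lets every first derivative of the edge sum be written with phi_1,
    so that phi_22 and the equality of mixed derivatives never come up. *)
Lemma partial2_Z2 (phi : R * R -> R) a b : Z2_invariant phi ->
  partial2 phi (a, b) = partial1 phi (b, a).
Proof.
move=> Z2; rewrite -[LHS]/(partial1 (fun p => phi (p.2, p.1)) (b, a)).
by congr (partial1 _ _); apply/funext => -[x y]; rewrite /= Z2.
Qed.

End TwoCoordinates.

(** * The Hessian of an edge sum *)

Section EdgeSumFunction.
Variables (R : realType) (n d : nat) (E : {set {set 'I_n}}).
Variables (rho tau : {set 'I_n} -> 'I_n) (phi : R * R -> R) (f : 'rV[R]_n -> R).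
Hypotheses (gE : cell_graph E) (ends : endpoints E rho tau).
Hypotheses (dphi : forall p, differentiable phi p)
           (dphi1 : forall p, differentiable (partial1 phi) p).
Hypotheses (Z2 : Z2_invariant phi).
Hypothesis fE :
  forall x : 'rV[R]_n, f x = \sum_(e in E) phi (x 0 (rho e), x 0 (tau e)).

Lemma edge_sum_differentiable x : differentiable f x.
Proof.
rewrite (funext fE); apply: differentiable_bigsum => e _.
exact: differentiable_coord2.
Qed.

Lemma edge_sum_derive x w : 'D_w f x =
  \sum_u w 0 u * \sum_(v | adj E u v) partial1 phi (x 0 u, x 0 v).
Proof.
pose F u v := w 0 u * partial1 phi (x 0 u, x 0 v).
have dsum := is_derive_bigsum (index_enum _) (fun e (_ : e \in E) =>
  is_derive_coord2 w (dphi (x 0 (rho e), x 0 (tau e)))).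
rewrite (funext fE) (@derive_val _ _ _ _ _ _ _ dsum).
transitivity (\sum_(e in E) (F (rho e) (tau e) + F (tau e) (rho e))).
  by apply: eq_bigr => e _; rewrite (partial2_Z2 _ _ Z2).
by rewrite (sum_arcs _ gE ends); apply: eq_bigr => u _; rewrite mulr_sumr.
Qed.

Lemma edge_sum_partial i : partial i f =
  fun x : 'rV[R]_n => \sum_(v | adj E i v) partial1 phi (x 0 i, x 0 v).
Proof.
apply/funext => x; rewrite /partial edge_sum_derive (bigD1 i) //=.
rewrite !mxE !eqxx mul1r [X in _ + X]big1 ?addr0 // => u ui.
by rewrite mxE (negPf ui) andbF mul0r.
Qed.

Lemma edge_sum_partial_differentiable i x : differentiable (partial i f) x.
Proof.
rewrite edge_sum_partial; apply: differentiable_bigsum => v _.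
exact: differentiable_coord2.
Qed.

(** At a synchronous point the second derivatives of phi are taken at the same
    point (x0, x0) for every edge, and regularity makes the diagonal constant;
    so the Hessian is an affine function of the Laplacian. *)
Lemma hessian_synchronous (x0 : R) : regular E d ->
  let a := partial1 (partial1 phi) (x0, x0) in
  let b := partial2 (partial1 phi) (x0, x0) in
  hessian f (const_mx x0) = (d%:R * (a + b))%:M - b *: laplacian_mx E R.
Proof.
move=> reg a b; apply/matrixP => i j; rewrite !mxE edge_sum_partial.
have dsum := is_derive_bigsum (index_enum _) (fun v (_ : adj E j v) =>
  is_derive_coord2 (delta_mx 0 i) (dphi1 (const_mx x0 0 j, const_mx x0 0 v))).
rewrite /partial (@derive_val _ _ _ _ _ _ _ dsum).
under eq_bigr do rewrite !mxE -/a -/b eqxx /=.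
rewrite big_split /=.
rewrite [X in X + _](@sum_neighbours_const R n E (_ * a)).
rewrite !reg.
have -> : \sum_(v | adj E j v) (v == i)%:R * b = (adj E i j)%:R * b.
  rewrite -mulr_suml adj_sym; congr (_ * _).
  rewrite big_mkcond (bigD1 i) //= eqxx big1 ?addr0; first by case: adj.
  by move=> v /negPf ->; rewrite if_same.
rewrite [j == i]eq_sym; case: eqVneq => [->|_] /=; rewrite ?mulr1n ?mulr0n; ring.
Qed.

End EdgeSumFunction.

(** * The criterion *)

(** Nondegeneracy enters here: it upgrades the necessary condition that the
    Hessian be positive semidefinite to strict inequalities. *)
Lemma psd_unitmx_eigen_gt0 (R : realType) (n : nat) (H : 'M[R]_n)
    (v : 'rV[R]_n) (mu : R) :
  H \in unitmx -> (forall w, 0 <= quad H w) -> v != 0 -> v *m H = mu *: v ->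
  0 < mu.
Proof.
move=> uH psd v0 vH; rewrite lt_def; apply/andP; split; last first.
  by have := psd v; rewrite (quad_eigen vH) pmulr_lge0 // dotvv_gt0.
apply: contra_neq v0 => mu0.
by rewrite -(mulmxK uH v) vH mu0 scale0r mul0mx.
Qed.

Theorem proposition3p1 (R : realType) (n d : nat) (E : {set {set 'I_n}})
    (rho tau : {set 'I_n} -> 'I_n) (phi : R * R -> R) (f : 'rV[R]_n -> R)
    (x0 lambda : R) :
  cell_graph E ->
  (1 <= d)%N ->
  regular E d ->
  endpoints E rho tau ->
  smooth phi ->
  Z2_invariant phi ->
  (forall x : 'rV[R]_n, f x = \sum_(e in E) phi (x 0 (rho e), x 0 (tau e))) ->
  greatest_eigenvalue (laplacian_mx E R) lambda ->
  critical_point f (const_mx x0) ->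
  hessian f (const_mx x0) \in unitmx ->
  local_minimum f (const_mx x0) <->
    (0 < partial1 (partial1 phi) (x0, x0) + partial2 (partial1 phi) (x0, x0) /\
     0 < partial1 (partial1 phi) (x0, x0)
         + (1 - lambda / d%:R) * partial2 (partial1 phi) (x0, x0)).
Proof.
move=> gE d1 reg ends smo Z2 fE [eigL maxL] crit.
have [dphi dphi1] : (forall p, differentiable phi p) /\
    (forall p, differentiable (partial1 phi) p).
  by have [dphi /(_ (1, 0)) []] := smo 2%N.
have df := edge_sum_differentiable dphi fE.
have d2f i := edge_sum_partial_differentiable gE ends dphi dphi1 Z2 fE i (const_mx x0).
have := hessian_synchronous gE ends dphi dphi1 Z2 fE x0 reg.
set a := partial1 _ _; set b := partial2 _ _; set H := hessian _ _ => /= HE uH.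
have n0 := cell_graph_nonempty gE.
have d0 : 0 < d%:R :> R by rewrite ltr0n.
have HL (v : 'rV[R]_n) mu : v *m laplacian_mx E R = mu *: v ->
    v *m H = (d%:R * (a + b) - b * mu) *: v.
  by move=> vL; rewrite HE mulmxBr mul_mx_scalar -scalemxAr vL scalerA -scalerBl.
(* Both inequalities become statements about d (a + b) - b mu, for mu = 0 and
   mu = lambda. *)
have -> : a + (1 - lambda / d%:R) * b = (d%:R * (a + b) - b * lambda) / d%:R.
  by field; rewrite gt_eqF.
rewrite pmulr_lgt0 ?invr_gt0 //.
split=> [minf|[ab abl]].
  have psd := local_minimum_hessian_psd df d2f crit minf.
  split.
    have one0 : const_mx 1 != 0 :> 'rV[R]_n.
      apply/eqP => /rowP/(_ (Ordinal n0)); rewrite !mxE => /eqP.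
      by rewrite oner_eq0.
    rewrite -(pmulr_rgt0 _ d0).
    have -> : d%:R * (a + b) = d%:R * (a + b) - b * 0 by rewrite mulr0 subr0.
    apply: (psd_unitmx_eigen_gt0 uH psd one0); apply: HL.
    rewrite scale0r; apply/rowP => u; rewrite mulmx_laplacian [RHS]mxE.
    by rewrite big1 // => v _; rewrite ![const_mx _ _ _]mxE subrr.
  have /eigenvalueP[v /HL vH v0] := eigL.
  exact: psd_unitmx_eigen_gt0 uH psd v0 vH.
have c0 : 0 < d%:R * (a + b) by rewrite mulr_gt0.
pose c := Num.min (d%:R * (a + b)) (d%:R * (a + b) - b * lambda).
apply: (hessian_coercive_local_minimum df d2f crit (c := c)).
  by rewrite lt_min c0.
move=> v; apply: (@le_trans _ _ (c * dotv v v)).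
  by rewrite ler_wpM2l ?normr_sqr_le_dotvv // ltW // lt_min c0.
have [mu eigmu Lle] := rayleigh_max n0 (laplacian_sym R E).
have {}Lle : quad (laplacian_mx E R) v <= lambda * dotv v v.
  by apply: (le_trans (Lle v)); rewrite ler_wpM2r ?dotvv_ge0 // maxL.
have Lge : 0 <= quad (laplacian_mx E R) v.
  rewrite (quad_laplacian v gE ends).
  by apply: sumr_ge0 => e _; rewrite sqr_ge0.
have -> : quad H v = d%:R * (a + b) * dotv v v - b * quad (laplacian_mx E R) v.
  rewrite /quad HE mulmxBr mul_mx_scalar -scalemxAr.
  by rewrite -scaleN1r dotvDl !dotvZl mulN1r.
(* The form is affine in quad L v, so its minimum is at an endpoint of the range
   [0, lambda |v|^2]: the right one if b >= 0, the left one otherwise. *)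
have [b0|b0] := leP 0 b.
  apply: (@le_trans _ _ ((d%:R * (a + b) - b * lambda) * dotv v v)).
    by rewrite ler_wpM2r ?dotvv_ge0 // ge_min lexx orbT.
  by rewrite mulrBl lerB // -mulrA ler_wpM2l.
apply: (@le_trans _ _ (d%:R * (a + b) * dotv v v)).
  by rewrite ler_wpM2r ?dotvv_ge0 // ge_min lexx.
by rewrite lerDl oppr_ge0 mulr_le0_ge0 // ltW.
Qed.
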